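(* Let $R$ be a commutative ring and let $M$ be a non-zero multiplication $R$-module. Then $\mathrm{gr}(G_M(R))\in\{3,\infty\}$.
   Context: All rings are commutative with non-zero identity and all modules are unitary. $I(R)^*$ denotes the set of all non-trivial ideals of $R$, i.e. ideals $I$ with $I\neq 0$ and $I\neq R$. For a non-zero $R$-module $M$, the $M$-intersection graph of ideals of $R$, denoted $G_M(R)$, is the (simple) graph with vertex set $I(R)^*$ in which two distinct vertices $I$ and $J$ are adjacent if and only if $IM\cap JM\neq 0$. An $R$-module $M$ is a multiplication module if every submodule of $M$ is of the form $IM$ for some ideal $I$ of $R$. The girth $\mathrm{gr}(G)$ of a graph $G$ is the length of a shortest cycle in $G$, with $\mathrm{gr}(G)=\infty$ if $G$ contains no cycles. *)

(* Defs.v *)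
From HB Require Import structures.
From mathcomp Require Import all_boot all_order all_algebra.
From mathcomp Require Import boolp classical_sets constructive_ereal.

Set Implicit Arguments.
Unset Strict Implicit.
Unset Printing Implicit Defensive.

Import Order.TTheory GRing.Theory Num.Theory.

Local Open Scope classical_set_scope.
Local Open Scope ring_scope.

(* [mem N] views the classical set N as the predicate expected by the library's
   closure properties. *)
Definition is_submodule (R : comNzRingType) (V : lmodType R) (N : set V) : Prop :=
  submod_closed (mem N).

Definition is_ideal (R : comNzRingType) (I : set R) : Prop :=
  @is_submodule R R^o I.

Definition nontrivial_ideals (R : comNzRingType) : set (set R) :=
  [set I | [/\ is_ideal I, I <> [set 0] & I <> [set: R]]].
Arguments nontrivial_ideals : clear implicits.

Definition ideal_mul (R : comNzRingType) (M : lmodType R) (I : set R) : set M :=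
  [set x | exists (n : nat) (a : 'I_n -> R) (m : 'I_n -> M),
     (forall i, I (a i)) /\ x = \sum_(i < n) a i *: m i].
Arguments ideal_mul {R} M I.

Definition multiplication_module (R : comNzRingType) (M : lmodType R) : Prop :=
  forall N : set M, is_submodule N ->
    exists2 I : set R, is_ideal I & N = ideal_mul M I.

(* Possibly infinite; the adjacency relation is Prop-valued because adjacency
   need not be decidable. *)
Record simple_graph := SimpleGraph {
  vertex :> choiceType;
  adj : vertex -> vertex -> Prop;
  adj_sym : forall x y, adj x y -> adj y x;
  adj_irr : forall x, ~ adj x x }.

Definition has_cycle_of_length (G : simple_graph) (n : nat) : Prop :=
  exists s : seq G,
    [/\ (3 <= n)%N, size s = n & ucycle (fun x y : G => `[< adj x y >]) s].

Definition girth (G : simple_graph) : \bar nat :=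
  match pselect (exists n, `[< has_cycle_of_length G n >]) with
  | left ex_cycle => EFin (ex_minn ex_cycle)
  | right _ => EPInf nat
  end.

Section IntersectionGraph.
Variables (R : comNzRingType) (M : lmodType R).

Definition intersection_adj (I J : nontrivial_ideals R) : Prop :=
  I <> J /\ ideal_mul M (val I) `&` ideal_mul M (val J) <> [set 0].

Lemma intersection_adj_sym I J : intersection_adj I J -> intersection_adj J I.
Proof. by move=> [neIJ IJ0]; split; [exact/nesym | rewrite setIC]. Qed.

Lemma intersection_adj_irr I : ~ intersection_adj I I.
Proof. by case. Qed.

Definition intersection_graph : simple_graph :=
  SimpleGraph intersection_adj_sym intersection_adj_irr.

End IntersectionGraph.

(* Main.v *)
(** If [IM ∩ JM = KM ≠ 0], then either [I, J, K] is a triangle or [IM] and [JM]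
    are comparable (for [K = R] they coincide). In a path [I - J - L - P] of
    vertices without a triangle, [J] must be strictly above both [I] and [L],
    and [L] strictly above both [J] and [P], which is absurd. *)
Require Import Defs.
From HB Require Import structures.
From mathcomp Require Import all_boot all_order all_algebra.
From mathcomp Require Import boolp classical_sets constructive_ereal.

Set Implicit Arguments.
Unset Strict Implicit.
Unset Printing Implicit Defensive.

Import GRing.Theory.

Local Open Scope classical_set_scope.
Local Open Scope ring_scope.

(** Trades membership in the predicate [mem N] for plain application of the classical set [N]. *)
Lemma is_submoduleP (R : comNzRingType) (V : lmodType R) (N : set V) :
  is_submodule N <->
  N 0 /\ (forall (a : R) u v, N u -> N v -> N (a *: u + v)).
Proof.
split=> [[N0 NZD]|[N0 NZD]].
  split=> [|a u v Nu Nv]; first exact: set_mem.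
  by apply: set_mem; apply: NZD; apply: mem_set.
split=> [|a u v Nu Nv]; first exact: mem_set.
by apply: mem_set; apply: NZD; apply: set_mem.
Qed.

Section IdealMul.
Variables (R : comNzRingType) (M : lmodType R).
Implicit Types I J : set R.

Lemma is_submoduleI (N P : set M) :
  is_submodule N -> is_submodule P -> is_submodule (N `&` P).
Proof.
move=> /is_submoduleP[N0 NZD] /is_submoduleP[P0 PZD]; apply/is_submoduleP.
by split=> [//|a u v [Nu Pu] [Nv Pv]]; split; [exact: NZD | exact: PZD].
Qed.

Lemma ideal_mul_submodule I : is_ideal I -> is_submodule (ideal_mul M I).
Proof.
move=> /is_submoduleP[I0 IZD]; apply/is_submoduleP; split.
  exists 0%N, (fun=> 0), (fun=> 0); split=> [[]//|].
  by rewrite big_ord0.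
move=> c u v [n [a [m [Ia ->]]]] [p [b [q [Ib ->]]]].
(* The two sums are concatenated, with the scalar [c] absorbed into the coefficients of the
   first. *)
exists (n + p)%N,
  (fun i => match fintype.split i with inl j => c * a j | inr k => b k end),
  (fun i => match fintype.split i with inl j => m j | inr k => q k end).
split=> [i|].
  case: (fintype.split i) => [j|//].
  by rewrite -[c * a j]addr0; exact: (IZD c).
rewrite big_split_ord /= scaler_sumr; congr (_ + _).
  apply: eq_bigr => j _.
  (* Seen as an [unsplit], the shifted index lets [unsplitK] evaluate the case analysis on
     [split]. *)
  by rewrite -[lshift p j]/(unsplit (inl j)) unsplitK scalerA.
by apply: eq_bigr => k _; rewrite -[rshift n k]/(unsplit (inr k)) unsplitK.
Qed.

Lemma ideal_mul0 : ideal_mul M [set 0] = [set 0].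
Proof.
apply/seteqP; split=> [x [n [a [m [a0 ->]]]]|x ->] /=.
  by rewrite big1 // => i _; rewrite (a0 i) scale0r.
by exists 0%N, (fun=> 0), (fun=> 0); split=> [[]//|]; rewrite big_ord0.
Qed.

Lemma ideal_mulT : ideal_mul M [set: R] = [set: M].
Proof.
apply/seteqP; split=> [//|x _].
by exists 1%N, (fun=> 1), (fun=> x); split=> //; rewrite big_ord1 scale1r.
Qed.

End IdealMul.

Section Triangles.
Variables (R : comNzRingType) (M : lmodType R).
Let G := intersection_graph M.
Implicit Types I J K L P : G.
Let mulM I : set M := ideal_mul M (val I).

Lemma triangle_of_adj I J K :
  adj I J -> adj J K -> adj K I -> has_cycle_of_length G 3.
Proof.
move=> IJ JK KI; exists [:: I; J; K]; split=> //; apply/andP; split.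
  by rewrite /= !asboolT.
have neq (x y : G) : adj x y -> (x == y) = false.
  by case=> xy _; apply/eqP.
by rewrite cons_uniq !inE (neq _ _ IJ) eq_sym (neq _ _ KI) /= inE (neq _ _ JK).
Qed.

Lemma is_ideal_vertex I : is_ideal (val I).
Proof. by case: (set_mem (valP I)). Qed.

Lemma ideal_mul_vertex0 I : mulM I 0.
Proof.
by have /is_submoduleP[] := ideal_mul_submodule M (is_ideal_vertex I).
Qed.

Lemma adj_ideal_mul_neq0 I J : adj I J -> mulM I <> [set 0].
Proof.
move=> [_ IJ0] I0; apply: IJ0; rewrite -/(mulM I) I0.
apply/seteqP; split=> [x []//|_ ->].
by split=> //; exact: ideal_mul_vertex0.
Qed.

(** A non-zero $KM$ inside both $IM$ and $JM$ keeps $IM \cap JM$ from vanishing. [K] may be [I] or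
    [J] itself. *)
Lemma adj_of_common_sub I J K : I <> J -> mulM K <> [set 0] ->
  mulM K `<=` mulM I -> mulM K `<=` mulM J -> adj I J.
Proof.
move=> IJ K0 KI KJ; split=> // IJ0; apply: K0.
apply/seteqP; split=> [x Kx|_ ->]; last exact: ideal_mul_vertex0.
by rewrite -IJ0; split; [exact: KI | exact: KJ].
Qed.

Hypothesis M_mult : multiplication_module M.

Lemma adj_comparable I J : ~ has_cycle_of_length G 3 -> adj I J ->
  mulM I `<=` mulM J \/ mulM J `<=` mulM I.
Proof.
move=> no_triangle IJ; have [neIJ IJ0] := IJ.
have [A idA eqA] := M_mult (is_submoduleI
  (ideal_mul_submodule M (is_ideal_vertex I))
  (ideal_mul_submodule M (is_ideal_vertex J))).
have AI : ideal_mul M A `<=` mulM I by rewrite -eqA; exact: subIsetl.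
have AJ : ideal_mul M A `<=` mulM J by rewrite -eqA; exact: subIsetr.
rewrite eqA in IJ0.
(* If $A = R$, then $IM \cap JM = M$, so $JM$ is everything and contains $IM$. Otherwise [A] is a
   vertex, being non-zero because $AM \neq 0$. *)
have [AT|neAT] := pselect (A = [set: R]).
  by left=> x _; apply: AJ; rewrite AT ideal_mulT.
have vA : nontrivial_ideals R A.
  by split=> // A0; apply: IJ0; rewrite A0 ideal_mul0.
pose K : G := SigSub (mem_set vA).
have [KI|neKI] := pselect (K = I); first by left; rewrite -KI.
have [KJ|neKJ] := pselect (K = J); first by right; rewrite -KJ.
(* [K] is now a third vertex, and $KM$ is the non-zero common submodule witnessing both of its
   edges. *)
case: no_triangle; apply: (@triangle_of_adj I J K) => //.
  by apply: (@adj_of_common_sub _ _ K) => //; exact: nesym.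
exact: (@adj_of_common_sub _ _ K).
Qed.

(** Without triangles, [I] and [L] are not adjacent. Were $JM \subseteq LM$, the smaller of the
    comparable $IM$ and $JM$ would be non-zero and lie in both $IM$ and $LM$, making them adjacent.
    Comparability of $JM$ and $LM$ then leaves only $LM \subseteq JM$. *)
Lemma path_middle_above I J L : ~ has_cycle_of_length G 3 ->
  adj I J -> adj J L -> I <> L ->
  mulM L `<=` mulM J /\ ~ mulM J `<=` mulM L.
Proof.
move=> no_triangle IJ JL neIL.
have nadjIL : ~ adj I L.
  by move=> IL; apply: no_triangle; apply: (triangle_of_adj IJ JL (adj_sym IL)).
have I0 := adj_ideal_mul_neq0 IJ; have J0 := adj_ideal_mul_neq0 JL.
have nJL : ~ mulM J `<=` mulM L.
  move=> sJL; apply: nadjIL.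
  have [sIJ|sJI] := adj_comparable no_triangle IJ.
    by apply: (@adj_of_common_sub _ _ I) => //; exact: subset_trans sJL.
  exact: (@adj_of_common_sub _ _ J).
by split=> //; have [/nJL|] := adj_comparable no_triangle JL.
Qed.

Lemma triangle_of_path I J L P : adj I J -> adj J L -> adj L P ->
  I <> L -> J <> P -> has_cycle_of_length G 3.
Proof.
move=> IJ JL LP neIL neJP; apply: contrapT => no_triangle.
have [_ nJL] := path_middle_above no_triangle IJ JL neIL.
(* The reversed path [P], [L], [J] has middle vertex [L], so it yields the inclusion just
   excluded. *)
have [sJL _] := path_middle_above no_triangle (adj_sym LP) (adj_sym JL)
  (nesym neJP).
exact: nJL sJL.
Qed.

Lemma triangle_of_cycle n :
  has_cycle_of_length G n -> has_cycle_of_length G 3.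
Proof.
(* Lists of fewer than three vertices violate the length bound, and three vertices are already a
   triangle. A longer cycle enters only through the path formed by its first four vertices. *)
move=> [[|I [|J [|L [|P s]]]] [n3 sz]]; rewrite -sz // in n3 *.
  by move=> c; exists [:: I; J; L].
case/andP=> /and4P[/asboolP IJ /asboolP JL /asboolP LP _].
rewrite !cons_uniq !in_cons.
move=> /and3P[/norP[_ /norP[/eqP IL _]] /norP[_ /norP[/eqP JP _]] _].
exact: (triangle_of_path IJ JL LP).
Qed.

End Triangles.

Theorem theorem4 (R : comNzRingType) (M : lmodType R)
    (M_neq0 : exists x : M, x <> 0%R)
    (M_mult : multiplication_module M) :
  girth (intersection_graph M) = 3%N%:E%E \/ girth (intersection_graph M) = +oo%E.
Proof.
rewrite /girth; case: pselect => [ex_cycle|]; [left | by right].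
case: ex_minnP => n /asboolP cyc_n min_n; congr (_%:E)%E; apply/eqP.
(* The minimal length is at least 3 by the definition of a cycle, and at most 3 because any cycle
   yields a triangle. *)
have [s [n3 _ _]] := cyc_n.
by rewrite eqn_leq n3 min_n //; apply/asboolP; exact: triangle_of_cycle cyc_n.
Qed.
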